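(* Let $q_1,q_2,Y_1,Y_2,\rho>0$ and initial prices $p_{1,0},p_{2,0}>0$ satisfy $p_{2,0}'q_2\le p_{1,0}q_1$, and suppose $(Y_1,Y_2)$ lies in zone I: $0<Y_1<p_{1,0}q_1$, $0<Y_2<p_{2,0}q_2$. Zone I is divided into: Zone I-1: $q_1\le\frac{Y_1}{p_{1,0}}+\frac{Y_2}{p_{1,0}'}$ (on or above $\ell_{1,0}$); Zone I-2: $\frac{Y_1}{p_{1,0}}+\frac{Y_2}{p_{1,0}'}<q_1$ (strictly below $\ell_{1,0}$) and $q_2\le\frac{Y_1}{p_{2,0}'}+\frac{Y_2}{p_{2,0}}$ (on or above $\ell_{2,0}$); Zone I-3: $q_2>\frac{Y_1}{p_{2,0}'}+\frac{Y_2}{p_{2,0}}$ (strictly below $\ell_{2,0}$). Write $\Delta p=p_{1,0}-p_{2,0}$. Then: a) In zone I-1 the NE at the initial prices and the price evolution are: I) if $\Delta p\in[-\rho,\rho]$: NE $\Big(\frac{Y_1}{p_{1,0}},0,0,\frac{Y_2}{p_{2,0}}\Big)$; after one downward price adjustment a type $E$ equilibrium is reached. II) if $\Delta p<-\rho$: NE $\Big(\frac{Y_1}{p_{1,0}},0,q_1-\frac{Y_1}{p_{1,0}},\frac{Y_2-p_{1,0}'(q_1-Y_1/p_{1,0})}{p_{2,0}}\Big)$; 1) when $(Y_1,Y_2)$ is strictly above $\ell_{1,0}$, after one downward adjustment in $p_{2,0}$ an $\ell_4$-equilibrium is reached; 2) when $(Y_1,Y_2)\in\ell_{1,0}$, a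 degenerate $\ell_1$-equilibrium is reached ($p_{2,t}=0$ for all $t\ge1$). III) if $\Delta p>\rho$: NE $\Big(\frac{Y_1-p_{2,0}'(q_2-Y_2/p_{2,0})}{p_{1,0}},q_2-\frac{Y_2}{p_{2,0}},0,\frac{Y_2}{p_{2,0}}\Big)$; after one downward adjustment in $p_{1,0}$ an $\ell_3$-equilibrium is reached. b) In zone I-2: I) if $\Delta p\in[-\rho,\rho]$: the NE and the price evolution are as in a) I). II) if $\Delta p<-\rho$: NE $\Big(\frac{Y_1}{p_{1,0}},0,\frac{Y_2}{p_{1,0}'},0\Big)$; there is an infinite downward adjustment process in $p_{1,t}$, under which $p_{1,t}$ tends monotonically to $$p_{1,\infty}=\frac1{2q_1}\Big(Y_1+Y_2-\rho q_1+\sqrt{(Y_1+Y_2-\rho q_1)^2+4\rho q_1Y_1}\Big),$$ while $p_{2,t}=0$ for all $t\ge1$ (the system tends to a degenerate $\ell_1$-equilibrium with limit line $\frac{\tilde Y_1}{p_{1,\infty}}+\frac{\tilde Y_2}{p_{1,\infty}+\rho}=q_1$). III) if $\Delta p>\rho$: the NE and the price evolution are as in a) III). c) In zone I-3: I) if $\Delta p\in[-\rho,\rho]$: the NE and the price evolution are as in a) I). II) if $\Delta p<-\rho$: the NE and the price evolution are as in b) II). III) if $\Delta p>\rho$: NE $\Big(0,\frac{Y_1}{p_{2,0}'},0,\frac{Y_2}{p_{2,0}}\Big)$; through an infinite downward adjustment process for the second price the system tends to a degenerate $\ell_2$-equilibrium.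
   Context: Model. Fix $q_1,q_2>0$ (quantities supplied each period in regions I and II), $Y_1,Y_2>0$ (per-period incomes of consumers I and II) and $\rho>0$ (transportation cost). For prices $p_1,p_2\ge 0$ write $p_i'=p_i+\rho$ (and $p_{i,t}'=p_{i,t}+\rho$). In each period the following game is played. Consumer I chooses $(\alpha,\beta)\in S_1=\{\alpha,\beta\ge0,\ \alpha p_1+\beta p_2'\le Y_1\}$ (orders in regions I and II); consumer II chooses $(\gamma,\delta)\in S_2=\{\gamma,\delta\ge0,\ \gamma p_1'+\delta p_2\le Y_2\}$ (orders in regions I and II). Payoffs: $P_1=\min(\alpha,q_1)+\min(\beta,\max(0,q_2-\delta))$ and $P_2=\min(\delta,q_2)+\min(\gamma,\max(0,q_1-\alpha))$. Selected best replies. Given $(\gamma,\delta)$, consumer I's best reply is the maximizer of $P_1$ over $S_1$ that (SR1) among all maximizers minimizes the expenditure $p_1\alpha+p_2'\beta$, and (SR2) among those has the largest home order $\alpha$; (SR3) if $p_1=0$ the home order is instead set to $\alpha=q_1$. Given $(\alpha,\beta)$, consumer II's best reply is the maximizer of $P_2$ over $S_2$ that (SR1) minimizes $p_1'\gamma+p_2\delta$, and (SR2) among those has the largest home order $\delta$; (SR3) if $p_2=0$ the home order is set to $\delta=q_2$. A Nash equilibrium (NE) at prices $(p_1,p_2)$ is a quadruple $(\alpha,\beta,\gamma,\delta)$ in which each consumer's orders are the selected best reply to the other's. Price dynamics (discrete time). At time $t$, with prices $p_{1,t},p_{2,t}$ and corresponding NE $(\alpha,\beta,\gamma,\delta)$,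 put $q_1^{cons}=\alpha+\gamma$, $q_2^{cons}=\beta+\delta$, $Y_1^{res}=Y_1-p_{2,t}'\beta$, $Y_2^{res}=Y_2-p_{1,t}'\gamma$. If $q_i^{cons}<q_i$, then $p_{i,t+1}=p_{i,t}q_i^{cons}/q_i$ (downward adjustment); if $Y_i^{res}>p_{i,t}q_i$, then $p_{i,t+1}=Y_i^{res}/q_i$ (upward adjustment); otherwise $p_{i,t+1}=p_{i,t}$. Lines in the $(\tilde Y_1,\tilde Y_2)$-plane at prices $(p_1,p_2)$: $\ell_1:\ q_1=\frac{\tilde Y_1}{p_1}+\frac{\tilde Y_2}{p_1'}$; $\ell_2:\ q_2=\frac{\tilde Y_1}{p_2'}+\frac{\tilde Y_2}{p_2}$; $\ell_3:\ p_1q_1+p_2'q_2=\tilde Y_1+\frac{p_2'}{p_2}\tilde Y_2$; $\ell_4:\ p_1'q_1+p_2q_2=\frac{p_1'}{p_1}\tilde Y_1+\tilde Y_2$. The lines at time-$t$ prices are denoted $\ell_{i,t}$. A point is above (below) a line if the side containing $\tilde Y_1,\tilde Y_2$ is larger (smaller) than the other side. A point of equilibrium (p.e.) for prices is a pair $(p_1,p_2)$ whose NE satisfies $\alpha+\gamma=q_1$, $\beta+\delta=q_2$, $p_1\alpha+p_2'\beta=Y_1$, $p_1'\gamma+p_2\delta=Y_2$; then prices remain unchanged. A type $E$ equilibrium is a p.e. with $p_i=Y_i/q_i$, $i=1,2$. An $\ell_4$-equilibrium is a p.e. with $Y_1<p_1q_1$, $p_2q_2\le Y_2$ and $(Y_1,Y_2)\in\ell_4$.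 An $\ell_3$-equilibrium is a p.e. (with $p_1\ge0$, $p_2>0$) such that $p_1q_1\le Y_1$, $Y_2<p_2q_2$ and $(Y_1,Y_2)\in\ell_3$. A degenerate $\ell_1$-equilibrium is a p.e. with $p_1>0$, $p_2=0$ and $(Y_1,Y_2)\in\ell_1$; a degenerate $\ell_2$-equilibrium is a p.e. with $p_1=0$, $p_2>0$ and $(Y_1,Y_2)\in\ell_2$. The system ''tends to'' a degenerate $\ell_1$- (resp. $\ell_2$-) equilibrium through an infinite downward adjustment process in $p_1$ (resp. $p_2$) if $p_{2,t}=0$ (resp. $p_{1,t}=0$) for all $t\ge1$ and the other price decreases at every step, converging to a value such that the limit prices form a degenerate $\ell_1$- (resp. $\ell_2$-) equilibrium. *)

(* Defs.v *)
From Stdlib Require Export Reals.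
Open Scope R_scope.

Record market := Market { q1 : R; q2 : R; Y1 : R; Y2 : R; rho : R }.

(* alpha, beta: orders of consumer I in regions I, II;
   gamma, delta: orders of consumer II in regions I, II. *)
Record orders := Orders { alpha : R; beta : R; gamma : R; delta : R }.

(* The two consumers play symmetric roles, so a single best reply is written in
   terms of a home order h and a foreign order f, the home price ph, the
   foreign price pf with transportation cost already included, the supplies
   qh and qf, the income Y, and the order d that the other consumer places in
   the foreign region (which is the other consumer's home). *)

Definition cost (ph pf h f : R) : R := h * ph + f * pf.

Definition feasible (ph pf Y h f : R) : Prop :=
  0 <= h /\ 0 <= f /\ cost ph pf h f <= Y.

Definition payoff (qh qf d h f : R) : R :=
  Rmin h qh + Rmin f (Rmax 0 (qf - d)).

Definition optimal (ph pf qh qf Y d h f : R) : Prop :=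
  feasible ph pf Y h f /\
  forall h' f', feasible ph pf Y h' f' ->
    payoff qh qf d h' f' <= payoff qh qf d h f.

Definition cheapest_optimal (ph pf qh qf Y d h f : R) : Prop :=
  optimal ph pf qh qf Y d h f /\
  forall h' f', optimal ph pf qh qf Y d h' f' ->
    cost ph pf h f <= cost ph pf h' f'.

(* At home price 0 the home orders of the cheapest maximizers are unbounded
   above, so the "largest home order" rule is replaced by h = qh. *)
Definition best_reply (ph pf qh qf Y d h f : R) : Prop :=
  cheapest_optimal ph pf qh qf Y d h f /\
  (ph <> 0 -> forall h' f',
     cheapest_optimal ph pf qh qf Y d h' f' -> h' <= h) /\
  (ph = 0 -> h = qh).

Definition is_NE (M : market) (p1 p2 : R) (e : orders) : Prop :=
  best_reply p1 (p2 + rho M) (q1 M) (q2 M) (Y1 M)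
             (delta e) (alpha e) (beta e) /\
  best_reply p2 (p1 + rho M) (q2 M) (q1 M) (Y2 M)
             (alpha e) (delta e) (gamma e).

Definition the_NE (M : market) (p1 p2 : R) (e : orders) : Prop :=
  is_NE M p1 p2 e /\ forall e', is_NE M p1 p2 e' -> e' = e.

Definition q1cons (e : orders) : R := alpha e + gamma e.
Definition q2cons (e : orders) : R := beta e + delta e.
Definition Y1res (M : market) (p2 : R) (e : orders) : R :=
  Y1 M - (p2 + rho M) * beta e.
Definition Y2res (M : market) (p1 : R) (e : orders) : R :=
  Y2 M - (p1 + rho M) * gamma e.

Definition downward (q qcons p pnext : R) : Prop :=
  qcons < q /\ pnext = p * qcons / q.

(* The first two premises exclude each other at a Nash equilibrium. *)
Definition adjust (q qcons Yres p pnext : R) : Prop :=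
  (qcons < q -> pnext = p * qcons / q) /\
  (p * q < Yres -> pnext = Yres / q) /\
  (~ qcons < q -> ~ p * q < Yres -> pnext = p).

Definition evolution (M : market) (p10 p20 : R)
    (p1 p2 : nat -> R) (e : nat -> orders) : Prop :=
  p1 O = p10 /\ p2 O = p20 /\
  forall t : nat,
    is_NE M (p1 t) (p2 t) (e t) /\
    adjust (q1 M) (q1cons (e t)) (Y1res M (p2 t) (e t)) (p1 t) (p1 (S t)) /\
    adjust (q2 M) (q2cons (e t)) (Y2res M (p1 t) (e t)) (p2 t) (p2 (S t)).

Definition downward1 (M : market) (p1 : nat -> R) (e : nat -> orders)
    (t : nat) : Prop :=
  downward (q1 M) (q1cons (e t)) (p1 t) (p1 (S t)).
Definition downward2 (M : market) (p2 : nat -> R) (e : nat -> orders)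
    (t : nat) : Prop :=
  downward (q2 M) (q2cons (e t)) (p2 t) (p2 (S t)).

(* Side of the equation of l1 (resp. l2) containing the point (y1, y2); the
   other side is q1 (resp. q2).  Here and in on_l3, on_l4 the denominators are
   nonzero wherever these definitions are used. *)
Definition l1_side (M : market) (p1 y1 y2 : R) : R :=
  y1 / p1 + y2 / (p1 + rho M).
Definition l2_side (M : market) (p2 y1 y2 : R) : R :=
  y1 / (p2 + rho M) + y2 / p2.

Definition on_l1 (M : market) (p1 p2 y1 y2 : R) : Prop :=
  q1 M = l1_side M p1 y1 y2.
Definition on_l2 (M : market) (p1 p2 y1 y2 : R) : Prop :=
  q2 M = l2_side M p2 y1 y2.
Definition on_l3 (M : market) (p1 p2 y1 y2 : R) : Prop :=
  p1 * q1 M + (p2 + rho M) * q2 M = y1 + (p2 + rho M) / p2 * y2.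
Definition on_l4 (M : market) (p1 p2 y1 y2 : R) : Prop :=
  (p1 + rho M) * q1 M + p2 * q2 M = (p1 + rho M) / p1 * y1 + y2.

Definition above_l1 (M : market) (p1 p2 y1 y2 : R) : Prop :=
  q1 M < l1_side M p1 y1 y2.

Definition is_pe (M : market) (p1 p2 : R) : Prop :=
  0 <= p1 /\ 0 <= p2 /\
  exists e, the_NE M p1 p2 e /\
    alpha e + gamma e = q1 M /\
    beta e + delta e = q2 M /\
    p1 * alpha e + (p2 + rho M) * beta e = Y1 M /\
    (p1 + rho M) * gamma e + p2 * delta e = Y2 M.

Definition typeE_eq (M : market) (p1 p2 : R) : Prop :=
  is_pe M p1 p2 /\ p1 = Y1 M / q1 M /\ p2 = Y2 M / q2 M.

(* p1 > 0 is implied by Y1 < p1 * q1. *)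
Definition l4_eq (M : market) (p1 p2 : R) : Prop :=
  is_pe M p1 p2 /\ Y1 M < p1 * q1 M /\ p2 * q2 M <= Y2 M /\
  on_l4 M p1 p2 (Y1 M) (Y2 M).

Definition l3_eq (M : market) (p1 p2 : R) : Prop :=
  is_pe M p1 p2 /\ 0 <= p1 /\ 0 < p2 /\
  p1 * q1 M <= Y1 M /\ Y2 M < p2 * q2 M /\
  on_l3 M p1 p2 (Y1 M) (Y2 M).

Definition degenerate_l1_eq (M : market) (p1 p2 : R) : Prop :=
  is_pe M p1 p2 /\ 0 < p1 /\ p2 = 0 /\ on_l1 M p1 p2 (Y1 M) (Y2 M).

Definition degenerate_l2_eq (M : market) (p1 p2 : R) : Prop :=
  is_pe M p1 p2 /\ p1 = 0 /\ 0 < p2 /\ on_l2 M p1 p2 (Y1 M) (Y2 M).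

(* From time 1 on, the prices are constant and form an equilibrium of kind K. *)
Definition reached_after_one_step (K : R -> R -> Prop) (p1 p2 : nat -> R)
    : Prop :=
  K (p1 1%nat) (p2 1%nat) /\
  forall t : nat, (1 <= t)%nat -> p1 t = p1 1%nat /\ p2 t = p2 1%nat.

Definition tends_to_degenerate_l1 (M : market) (p1 p2 : nat -> R)
    (e : nat -> orders) (p1inf : R) : Prop :=
  (forall t : nat, (1 <= t)%nat -> p2 t = 0) /\
  (forall t : nat, downward1 M p1 e t /\ p1 (S t) < p1 t) /\
  Un_cv p1 p1inf /\ degenerate_l1_eq M p1inf 0.

Definition tends_to_degenerate_l2 (M : market) (p1 p2 : nat -> R)
    (e : nat -> orders) (p2inf : R) : Prop :=
  (forall t : nat, (1 <= t)%nat -> p1 t = 0) /\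
  (forall t : nat, downward2 M p2 e t /\ p2 (S t) < p2 t) /\
  Un_cv p2 p2inf /\ degenerate_l2_eq M 0 p2inf.

Definition zone_I (M : market) (p10 p20 : R) : Prop :=
  0 < Y1 M < p10 * q1 M /\ 0 < Y2 M < p20 * q2 M.
Definition zone_I1 (M : market) (p10 p20 : R) : Prop :=
  zone_I M p10 p20 /\ q1 M <= l1_side M p10 (Y1 M) (Y2 M).
Definition zone_I2 (M : market) (p10 p20 : R) : Prop :=
  zone_I M p10 p20 /\
  l1_side M p10 (Y1 M) (Y2 M) < q1 M /\ q2 M <= l2_side M p20 (Y1 M) (Y2 M).
Definition zone_I3 (M : market) (p10 p20 : R) : Prop :=
  zone_I M p10 p20 /\ l2_side M p20 (Y1 M) (Y2 M) < q2 M.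

(* The three regimes below occur in more than one zone. *)

Definition regime_E (M : market) (p10 p20 : R)
    (p1 p2 : nat -> R) (e : nat -> orders) : Prop :=
  the_NE M p10 p20 (Orders (Y1 M / p10) 0 0 (Y2 M / p20)) /\
  downward1 M p1 e 0 /\ downward2 M p2 e 0 /\
  reached_after_one_step (typeE_eq M) p1 p2.

Definition regime_l3 (M : market) (p10 p20 : R)
    (p1 p2 : nat -> R) (e : nat -> orders) : Prop :=
  the_NE M p10 p20
    (Orders ((Y1 M - (p20 + rho M) * (q2 M - Y2 M / p20)) / p10)
            (q2 M - Y2 M / p20) 0 (Y2 M / p20)) /\
  downward1 M p1 e 0 /\ p2 1%nat = p20 /\
  reached_after_one_step (l3_eq M) p1 p2.

Definition p1_infinity (M : market) : R :=
  let s := Y1 M + Y2 M - rho M * q1 M in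
  1 / (2 * q1 M) * (s + sqrt (s ^ 2 + 4 * rho M * q1 M * Y1 M)).

Definition regime_infinite_l1 (M : market) (p10 p20 : R)
    (p1 p2 : nat -> R) (e : nat -> orders) : Prop :=
  the_NE M p10 p20 (Orders (Y1 M / p10) 0 (Y2 M / (p10 + rho M)) 0) /\
  tends_to_degenerate_l1 M p1 p2 e (p1_infinity M).

(* Main.v *)
Require Import Defs.
From Stdlib Require Import Reals Lra Lia FunctionalExtensionality.
Open Scope R_scope.

(** Each consumer solves a fractional knapsack problem, so a best reply is
    greedy: fill the cheaper source first, then the dearer one.  The game is
    easy to solve because at nonnegative prices the two consumers cannot both
    find the foreign region strictly cheaper: [p1 > p2 + rho] and
    [p2 > p1 + rho] contradict each other.  A consumer who buys at home first
    has a home order that does not depend on the other's orders; that order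
    determines the other's reply, and the other's reply determines the rest.
    Hence the greedy equilibrium written down at each price pair that the
    process visits is the only one ([the_NE_of_one_order]).  Since the adjustment rule
    is single-valued, the whole evolution is then forced by the initial prices,
    and it suffices to exhibit one trajectory in each regime
    ([forced_determined]).

    In zone I both incomes are too small to buy the home supply.

    - If the prices differ by at most [rho], both consumers spend everything at
      home, and one downward adjustment makes the home supplies cost exactly
      the incomes.
    - If [p1 + rho < p2], consumer I spends everything at home and consumer II
      buys in region I first.  On or above [l1], consumer II can empty region I;
      only [p2] then falls, to the value at which consumer II's remaining
      income buys [q2], and the budgets now balance: this is an
      [l4]-equilibrium, whose second price is [0] exactly on [l1].  Strictly
      below [l1], consumer II buys nothing at home, [p2] drops to [0], and from
      then on [p1] follows the recursion [p |-> (Y1 + Y2 p / (p + rho)) / q1].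
      Its positive fixed point is the price whose line [l1] passes through
      [(Y1, Y2)], namely [p1_infinity]; it is the positive root of a quadratic
      equation.  Above it the recursion decreases and contracts
      ([next_price_contracts]).
    - If [p1 > p2 + rho], exchanging the regions gives the previous case
      ([determined_swap]), with [l2] for [l1].

    The assumption [(p2 + rho) q2 <= p1 q1] makes the zones disjoint: under it
    a point below [l2] is below [l1] ([below_l2_below_l1]). *)

(** * Geometric convergence *)

Lemma geometric_cv (u : nat -> R) (l k : R) :
  0 <= k < 1 -> (forall t, 0 <= u (S t) - l <= k * (u t - l)) -> Un_cv u l.
Proof.
  intros hk h.
  assert (b : forall t, Rabs (u t - l) <= k ^ t * Rabs (u 0%nat - l)).
  { induction t as [| t IH]; [simpl; lra |].
    rewrite Rabs_pos_eq by apply h.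
    apply Rle_trans with (k * Rabs (u t - l)).
    - apply Rle_trans with (k * (u t - l)); [apply h |].
      apply Rmult_le_compat_l; [lra | apply Rle_abs].
    - simpl. rewrite Rmult_assoc. apply Rmult_le_compat_l; lra. }
  intros eps heps. set (c := Rabs (u 0%nat - l)) in *.
  assert (hc : 0 <= c) by apply Rabs_pos.
  destruct (pow_lt_1_zero k ltac:(rewrite Rabs_pos_eq; lra) (eps / (c + 1))
              ltac:(apply Rdiv_lt_0_compat; lra)) as [N HN].
  exists N. intros t ht. unfold Rdist.
  apply Rle_lt_trans with (k ^ t * c); [apply b |].
  specialize (HN t ht). rewrite Rabs_pos_eq in HN by (apply pow_le; lra).
  apply Rle_lt_trans with (eps / (c + 1) * c).
  - apply Rmult_le_compat_r; lra.
  - replace eps with (eps / (c + 1) * (c + 1)) at 2 by (field; lra).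
    apply Rmult_lt_compat_l; [apply Rdiv_lt_0_compat |]; lra.
Qed.

(** * Best replies *)

(** The selection rules alone leave no freedom: (SR2), or (SR3) when home goods
    are free, fixes the home order, and the common minimal expenditure then
    fixes the foreign order because the foreign price is positive. *)
Lemma best_reply_unique (ph pf qh qf Y d h f h' f' : R) :
  0 < pf ->
  best_reply ph pf qh qf Y d h f -> best_reply ph pf qh qf Y d h' f' ->
  h = h' /\ f = f'.
Proof.
  intros hpf [[o c] [l z]] [[o' c'] [l' z']].
  pose proof (c _ _ o') as c1. pose proof (c' _ _ o) as c2.
  assert (eh : h = h').
  { destruct (Req_dec ph 0) as [e | e].
    - rewrite (z e), (z' e); reflexivity.
    - apply Rle_antisym; [apply (l' e _ f) | apply (l e _ f')];
        split; assumption. }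
  split; [exact eh |]. subst h'. unfold cost in c1, c2.
  apply (Rmult_eq_reg_r pf); lra.
Qed.

(** Sufficiency of the Karush-Kuhn-Tucker conditions for the knapsack problem.
    The useful parts [a], [b] of any orders lie in the box below the supplies,
    where [(h, f)] maximizes the Lagrangian [lam * (a + b) - cost a b].  With
    complementary slackness (the budget is exhausted or the box is full) this
    makes [(h, f)] optimal.  The same inequality read at equal payoff bounds
    the cost from below, which is (SR1).  The last two hypotheses serve the
    selection rules (SR2), where ties are possible only at equal prices, and
    (SR3). *)
Lemma lagrangian_best_reply (lam ph pf qh qf Y d h f : R) :
  0 < lam -> 0 <= ph -> 0 < pf ->
  0 <= h <= qh -> 0 <= f <= Rmax 0 (qf - d) -> cost ph pf h f <= Y ->
  (forall a b, 0 <= a <= qh -> 0 <= b <= Rmax 0 (qf - d) ->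
     lam * (a + b) - cost ph pf a b <= lam * (h + f) - cost ph pf h f) ->
  (cost ph pf h f = Y \/ (h = qh /\ f = Rmax 0 (qf - d))) ->
  (ph = pf -> h = qh \/ f = 0) -> (ph = 0 -> h = qh) ->
  best_reply ph pf qh qf Y d h f.
Proof.
  intros hlam hph hpf hh hf hc hL hslack htie hfree.
  set (r := Rmax 0 (qf - d)) in *.
  assert (own : payoff qh qf d h f = h + f).
  { unfold payoff. fold r. rewrite Rmin_left, Rmin_left; lra. }
  (* Truncating orders at the supplies keeps the payoff and lowers the cost. *)
  assert (obtained : forall h' f', feasible ph pf Y h' f' ->
    exists a b, 0 <= a <= qh /\ 0 <= b <= r /\ a <= h' /\ b <= f' /\
      payoff qh qf d h' f' = a + b /\ cost ph pf a b <= cost ph pf h' f' <= Y).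
  { intros h' f' (h1 & h2 & h3).
    exists (Rmin h' qh), (Rmin f' r).
    assert (Rmin h' qh <= h') by apply Rmin_l.
    assert (Rmin h' qh <= qh) by apply Rmin_r.
    assert (Rmin f' r <= f') by apply Rmin_l.
    assert (Rmin f' r <= r) by apply Rmin_r.
    assert (0 <= Rmin h' qh) by (apply Rmin_glb; lra).
    assert (0 <= Rmin f' r) by (apply Rmin_glb; lra).
    repeat split; try lra. unfold cost.
    apply Rplus_le_compat; apply Rmult_le_compat_r; lra. }
  assert (opt : optimal ph pf qh qf Y d h f).
  { split; [repeat split; lra |]. intros h' f' F.
    destruct (obtained _ _ F) as (a & b & ha & hb & _ & _ & -> & hc').
    rewrite own. destruct hslack as [e | [-> ->]]; [| lra].
    pose proof (hL a b ha hb). apply (Rmult_le_reg_l lam); lra. }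
  assert (shadow : forall h' f', optimal ph pf qh qf Y d h' f' ->
    exists a b, 0 <= a <= qh /\ 0 <= b <= r /\ a <= h' /\ b <= f' /\
      a + b = h + f /\ cost ph pf h f <= cost ph pf a b <= cost ph pf h' f').
  { intros h' f' [F o].
    destruct (obtained _ _ F) as (a & b & ha & hb & h1 & h2 & e & hc').
    exists a, b. pose proof (o _ _ (proj1 opt)) as o1.
    pose proof (proj2 opt _ _ F) as o2. rewrite own, e in o1, o2.
    assert (es : a + b = h + f) by lra.
    pose proof (hL a b ha hb) as l. rewrite es in l.
    repeat split; lra. }
  split; [split; [exact opt |] | split; [| exact hfree]].
  - intros h' f' o. destruct (shadow _ _ o) as (a & b & H). lra.
  - intros hph0 h' f' [o c].
    destruct (shadow _ _ o) as (a & b & ha & hb & h1 & h2 & es & hc').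
    pose proof (c _ _ opt) as c'. unfold cost in *.
    assert (hpp : 0 < ph) by lra.
    assert (m1 : a * ph <= h' * ph) by (apply Rmult_le_compat_r; lra).
    assert (m2 : b * pf <= f' * pf) by (apply Rmult_le_compat_r; lra).
    (* The cost is minimal, so nothing is ordered beyond what is received. *)
    assert (ea : h' = a) by (apply (Rmult_eq_reg_r ph); lra).
    subst h'. destruct (Req_dec ph pf) as [e | e].
    + destruct (htie e); lra.
    + (* Equal payoff and equal cost are two independent linear equations. *)
      assert (ez : (a - h) * (ph - pf) = 0).
      { replace b with (h + f - a) in * by lra. lra. }
      apply Rmult_integral in ez. lra.
Qed.

Lemma saturating_best_reply (ph pf qh qf Y d h f : R) :
  0 <= ph -> 0 < pf -> 0 <= qh -> h = qh -> f = Rmax 0 (qf - d) ->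
  cost ph pf h f <= Y ->
  best_reply ph pf qh qf Y d h f.
Proof.
  intros hph hpf hqh eh ef hc.
  assert (0 <= Rmax 0 (qf - d)) by apply Rmax_l.
  (* A multiplier no smaller than either price makes every unit worth buying. *)
  apply (lagrangian_best_reply (ph + pf)); try lra.
  subst h f. intros a b ha hb. unfold cost.
  pose proof (Rmult_le_compat_l pf a qh ltac:(lra) ltac:(lra)).
  pose proof (Rmult_le_compat_l ph b (Rmax 0 (qf - d)) ltac:(lra) ltac:(lra)).
  lra.
Qed.

(** The multiplier is the price of the source used at the margin: [ph] while
    the home supply is not exhausted, [pf] once it is. *)
Lemma home_first_best_reply (ph pf qh qf Y d h f : R) :
  0 <= ph <= pf -> 0 < pf -> 0 <= h <= qh -> 0 <= f <= Rmax 0 (qf - d) ->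
  cost ph pf h f = Y -> (f = 0 /\ 0 < ph \/ h = qh) ->
  best_reply ph pf qh qf Y d h f.
Proof.
  intros hph hpf hh hf hc [[ef hp] | eh].
  - apply (lagrangian_best_reply ph); try lra.
    subst f. intros a b ha hb. unfold cost.
    pose proof (Rmult_le_compat_l b ph pf ltac:(lra) ltac:(lra)). lra.
  - apply (lagrangian_best_reply pf); try lra.
    subst h. intros a b ha hb. unfold cost.
    pose proof (Rmult_le_compat_l (pf - ph) a qh ltac:(lra) ltac:(lra)). lra.
Qed.

Lemma foreign_first_best_reply (ph pf qh qf Y d h f : R) :
  0 < pf < ph -> 0 <= h <= qh -> 0 <= f <= Rmax 0 (qf - d) ->
  cost ph pf h f = Y -> (h = 0 \/ f = Rmax 0 (qf - d)) ->
  best_reply ph pf qh qf Y d h f.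
Proof.
  intros hp hh hf hc [eh | ef].
  - apply (lagrangian_best_reply pf); try lra.
    subst h. intros a b ha hb. unfold cost.
    pose proof (Rmult_le_compat_l a pf ph ltac:(lra) ltac:(lra)). lra.
  - apply (lagrangian_best_reply ph); try lra.
    intros a b ha hb. unfold cost. rewrite ef.
    pose proof (Rmult_le_compat_l (ph - pf) b (Rmax 0 (qf - d))
                  ltac:(lra) ltac:(lra)). lra.
Qed.

Lemma poor_home_first_best_reply (ph pf qh qf Y d : R) :
  0 < ph <= pf -> 0 < Y <= ph * qh ->
  best_reply ph pf qh qf Y d (Y / ph) 0.
Proof.
  intros hp hY.
  assert (0 < Y / ph) by (apply Rdiv_lt_0_compat; lra).
  assert (e : Y / ph * ph = Y) by (field; lra).
  assert (Y / ph <= qh) by (apply (Rmult_le_reg_r ph); lra).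
  pose proof (Rmax_l 0 (qf - d)).
  apply home_first_best_reply; try lra. unfold cost; lra.
Qed.

(** When the other consumer buys up the foreign supply, the comparison of
    prices is irrelevant. *)
Lemma poor_lone_best_reply (ph pf qh qf Y d : R) :
  0 < ph -> 0 < pf -> 0 < Y <= ph * qh -> qf <= d ->
  best_reply ph pf qh qf Y d (Y / ph) 0.
Proof.
  intros hph hpf hY hd.
  destruct (Rle_lt_dec ph pf) as [c | c];
    [apply poor_home_first_best_reply; lra |].
  assert (0 < Y / ph) by (apply Rdiv_lt_0_compat; lra).
  assert (e : Y / ph * ph = Y) by (field; lra).
  assert (Y / ph <= qh) by (apply (Rmult_le_reg_r ph); lra).
  assert (Rmax 0 (qf - d) = 0) by (apply Rmax_left; lra).
  apply foreign_first_best_reply; try lra. unfold cost; lra.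
Qed.

(** The foreign order depends on [d], the home order does not: at an
    equilibrium the latter can be read off the prices alone. *)
Lemma rich_home_first_best_reply (ph pf qh qf Y d : R) :
  0 <= ph <= pf -> 0 < pf -> 0 <= qh -> ph * qh <= Y ->
  exists f, best_reply ph pf qh qf Y d qh f.
Proof.
  intros hp hpf hqh hY. pose proof (Rmax_l 0 (qf - d)) as hr.
  destruct (Rle_lt_dec (cost ph pf qh (Rmax 0 (qf - d))) Y) as [c | c].
  - exists (Rmax 0 (qf - d)). apply saturating_best_reply; lra.
  - exists ((Y - ph * qh) / pf). unfold cost in c.
    assert (e : (Y - ph * qh) / pf * pf = Y - ph * qh) by (field; lra).
    assert (0 <= (Y - ph * qh) / pf) by (apply (Rmult_le_reg_r pf); lra).
    assert ((Y - ph * qh) / pf <= Rmax 0 (qf - d))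
      by (apply (Rmult_le_reg_r pf); lra).
    apply home_first_best_reply; try lra. unfold cost; lra.
Qed.

(** * Nash equilibria *)

(** Each reply depends on the other's orders through the other's home order
    only, so uniqueness of best replies propagates from one home order to the
    whole quadruple. *)
Lemma the_NE_of_one_order (M : market) (p1 p2 : R) (e : orders) :
  0 <= p1 -> 0 <= p2 -> 0 < rho M ->
  is_NE M p1 p2 e ->
  (forall e', is_NE M p1 p2 e' -> alpha e' = alpha e \/ delta e' = delta e) ->
  the_NE M p1 p2 e.
Proof.
  intros h1 h2 hr N H. split; [exact N |]. intros e' N'.
  destruct N as [bI bII], N' as [bI' bII'].
  assert (h1' : 0 < p1 + rho M) by lra. assert (h2' : 0 < p2 + rho M) by lra.
  pose proof (H e' (conj bI' bII')) as Hc.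
  destruct e as [a b c d], e' as [a' b' c' d']; simpl in *.
  destruct Hc; subst.
  - destruct (best_reply_unique _ _ _ _ _ _ _ _ _ _ h1' bII bII'); subst.
    destruct (best_reply_unique _ _ _ _ _ _ _ _ _ _ h2' bI bI'); subst.
    reflexivity.
  - destruct (best_reply_unique _ _ _ _ _ _ _ _ _ _ h2' bI bI'); subst.
    destruct (best_reply_unique _ _ _ _ _ _ _ _ _ _ h1' bII bII'); subst.
    reflexivity.
Qed.

(** A consumer who buys at home first has a home order known independently of
    the opponent; this is where [the_NE_of_one_order] starts from. *)
Lemma NE_poor_home_first_alpha (M : market) (p1 p2 : R) (e : orders) :
  is_NE M p1 p2 e -> 0 < p1 <= p2 + rho M -> 0 < Y1 M <= p1 * q1 M ->
  alpha e = Y1 M / p1.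
Proof.
  intros [b _] hp hY. assert (hpf : 0 < p2 + rho M) by lra.
  apply (best_reply_unique _ _ _ _ _ _ _ _ _ 0 hpf b).
  apply poor_home_first_best_reply; lra.
Qed.

Lemma NE_rich_home_first_alpha (M : market) (p1 p2 : R) (e : orders) :
  is_NE M p1 p2 e -> 0 <= p1 <= p2 + rho M -> 0 < p2 + rho M ->
  0 <= q1 M -> p1 * q1 M <= Y1 M -> alpha e = q1 M.
Proof.
  intros [b _] hp hpf hq hY.
  destruct (rich_home_first_best_reply p1 (p2 + rho M) (q1 M) (q2 M) (Y1 M)
              (delta e)) as [f B]; try assumption.
  exact (proj1 (best_reply_unique _ _ _ _ _ _ _ _ _ _ hpf b B)).
Qed.

Lemma NE_rich_home_first_delta (M : market) (p1 p2 : R) (e : orders) :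
  is_NE M p1 p2 e -> 0 <= p2 <= p1 + rho M -> 0 < p1 + rho M ->
  0 <= q2 M -> p2 * q2 M <= Y2 M -> delta e = q2 M.
Proof.
  intros [_ b] hp hpf hq hY.
  destruct (rich_home_first_best_reply p2 (p1 + rho M) (q2 M) (q1 M) (Y2 M)
              (alpha e)) as [f B]; try assumption.
  exact (proj1 (best_reply_unique _ _ _ _ _ _ _ _ _ _ hpf b B)).
Qed.

Section PositiveMarket.

Variable M : market.
Hypothesis hq1 : 0 < q1 M.
Hypothesis hq2 : 0 < q2 M.
Hypothesis hY1 : 0 < Y1 M.
Hypothesis hY2 : 0 < Y2 M.
Hypothesis hrho : 0 < rho M.

Lemma the_NE_poor_home_first (p1 p2 : R) :
  0 < p1 <= p2 + rho M -> 0 < p2 <= p1 + rho M ->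
  Y1 M <= p1 * q1 M -> Y2 M <= p2 * q2 M ->
  the_NE M p1 p2 (Orders (Y1 M / p1) 0 0 (Y2 M / p2)).
Proof.
  intros h1 h2 hz1 hz2. apply the_NE_of_one_order; try lra.
  - split; simpl; apply poor_home_first_best_reply; lra.
  - intros e' N. left. simpl. apply (NE_poor_home_first_alpha _ _ _ _ N); lra.
Qed.

(** The new prices may differ by more than [rho].  This is harmless: each
    region's supply is entirely bought by its own consumer, so the foreign
    region has nothing to offer. *)
Lemma typeE_the_NE :
  the_NE M (Y1 M / q1 M) (Y2 M / q2 M) (Orders (q1 M) 0 0 (q2 M)).
Proof.
  assert (0 < Y1 M / q1 M) by (apply Rdiv_lt_0_compat; lra).
  assert (0 < Y2 M / q2 M) by (apply Rdiv_lt_0_compat; lra).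
  assert (e1 : Y1 M / q1 M * q1 M = Y1 M) by (field; lra).
  assert (e2 : Y2 M / q2 M * q2 M = Y2 M) by (field; lra).
  apply the_NE_of_one_order; try lra.
  - split; simpl; (apply saturating_best_reply; try lra;
      [rewrite Rmax_left; lra | unfold cost; lra]).
  - intros e' N. simpl.
    destruct (Rle_lt_dec (Y1 M / q1 M) (Y2 M / q2 M + rho M)).
    + left. apply (NE_rich_home_first_alpha _ _ _ _ N); lra.
    + right. apply (NE_rich_home_first_delta _ _ _ _ N); lra.
Qed.

(** Consumer II takes all that consumer I leaves in region I, and spends the
    remaining income, nonnegative on or above [l1], at home. *)
Lemma the_NE_foreign_sold_out (p1 p2 : R) :
  0 < p1 -> p1 + rho M < p2 -> Y1 M <= p1 * q1 M -> Y2 M <= p2 * q2 M ->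
  q1 M <= l1_side M p1 (Y1 M) (Y2 M) ->
  the_NE M p1 p2
    (Orders (Y1 M / p1) 0 (q1 M - Y1 M / p1)
       ((Y2 M - (p1 + rho M) * (q1 M - Y1 M / p1)) / p2)).
Proof.
  intros hp1 hdp hz1 hz2 hl. unfold l1_side in hl.
  assert (e1 : Y1 M / p1 * p1 = Y1 M) by (field; lra).
  assert (e2 : Y2 M / (p1 + rho M) * (p1 + rho M) = Y2 M) by (field; lra).
  assert (a1 : Y1 M / p1 <= q1 M) by (apply (Rmult_le_reg_r p1); lra).
  pose proof (Rmult_le_compat_r (p1 + rho M) (q1 M - Y1 M / p1)
                (Y2 M / (p1 + rho M)) ltac:(lra) ltac:(lra)) as a2.
  rewrite e2 in a2.
  pose proof (Rmult_le_pos (p1 + rho M) (q1 M - Y1 M / p1) ltac:(lra) ltac:(lra)).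
  set (w := Y2 M - (p1 + rho M) * (q1 M - Y1 M / p1)).
  assert (ew : w / p2 * p2 = w) by (field; lra).
  assert (0 <= w / p2) by (apply (Rmult_le_reg_r p2); unfold w in *; lra).
  assert (w / p2 <= q2 M) by (apply (Rmult_le_reg_r p2); unfold w in *; lra).
  assert (er : Rmax 0 (q1 M - Y1 M / p1) = q1 M - Y1 M / p1)
    by (apply Rmax_right; lra).
  apply the_NE_of_one_order; try lra.
  - split; simpl; [apply poor_home_first_best_reply; lra |].
    apply foreign_first_best_reply; try lra.
    unfold cost. rewrite ew. unfold w. lra.
  - intros e' N. left. simpl. apply (NE_poor_home_first_alpha _ _ _ _ N); lra.
Qed.

(** After [p2] has fallen, nothing is known about the order of [p1] and
    [p2 + rho], nor of [p2] and [p1 + rho].  Consumer II obtains everything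
    available, so the reply is the same in all cases; and at least one of the
    consumers buys at home first, which gives uniqueness. *)
Lemma l4_the_NE (p1 p2 : R) :
  0 < p1 -> 0 <= p2 -> Y1 M <= p1 * q1 M ->
  p2 * q2 M + (p1 + rho M) * (q1 M - Y1 M / p1) = Y2 M ->
  the_NE M p1 p2 (Orders (Y1 M / p1) 0 (q1 M - Y1 M / p1) (q2 M)).
Proof.
  intros hp1 hp2 hz1 hb.
  assert (e1 : Y1 M / p1 * p1 = Y1 M) by (field; lra).
  assert (a1 : Y1 M / p1 <= q1 M) by (apply (Rmult_le_reg_r p1); lra).
  pose proof (Rmult_le_pos (p1 + rho M) (q1 M - Y1 M / p1) ltac:(lra) ltac:(lra)).
  apply the_NE_of_one_order; try lra.
  - split; simpl; [apply poor_lone_best_reply; lra |].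
    apply saturating_best_reply; try lra.
    + rewrite Rmax_right; lra.
    + unfold cost. lra.
  - intros e' N. simpl. destruct (Rle_lt_dec p1 (p2 + rho M)).
    + left. apply (NE_poor_home_first_alpha _ _ _ _ N); lra.
    + right. apply (NE_rich_home_first_delta _ _ _ _ N); lra.
Qed.

Lemma the_NE_foreign_unsold (p1 p2 : R) :
  0 < p1 -> p1 + rho M < p2 -> l1_side M p1 (Y1 M) (Y2 M) <= q1 M ->
  the_NE M p1 p2 (Orders (Y1 M / p1) 0 (Y2 M / (p1 + rho M)) 0).
Proof.
  intros hp1 hdp hl. unfold l1_side in hl.
  assert (e1 : Y1 M / p1 * p1 = Y1 M) by (field; lra).
  assert (e2 : Y2 M / (p1 + rho M) * (p1 + rho M) = Y2 M) by (field; lra).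
  assert (0 < Y1 M / p1) by (apply Rdiv_lt_0_compat; lra).
  assert (0 < Y2 M / (p1 + rho M)) by (apply Rdiv_lt_0_compat; lra).
  pose proof (Rmult_le_compat_l p1 (Y1 M / p1) (q1 M) ltac:(lra) ltac:(lra)).
  assert (er : Rmax 0 (q1 M - Y1 M / p1) = q1 M - Y1 M / p1)
    by (apply Rmax_right; lra).
  apply the_NE_of_one_order; try lra.
  - split; simpl; [apply poor_home_first_best_reply; lra |].
    apply foreign_first_best_reply; try lra. unfold cost; lra.
  - intros e' N. left. simpl. apply (NE_poor_home_first_alpha _ _ _ _ N); lra.
Qed.

(** When region II's goods are free, rule (SR3) fixes consumer II's home order
    at [q2], and nothing is left there for consumer I. *)
Lemma the_NE_free (p1 : R) :
  0 < p1 -> l1_side M p1 (Y1 M) (Y2 M) <= q1 M ->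
  the_NE M p1 0 (Orders (Y1 M / p1) 0 (Y2 M / (p1 + rho M)) (q2 M)).
Proof.
  intros hp1 hl. unfold l1_side in hl.
  assert (e1 : Y1 M / p1 * p1 = Y1 M) by (field; lra).
  assert (e2 : Y2 M / (p1 + rho M) * (p1 + rho M) = Y2 M) by (field; lra).
  assert (0 < Y1 M / p1) by (apply Rdiv_lt_0_compat; lra).
  assert (0 < Y2 M / (p1 + rho M)) by (apply Rdiv_lt_0_compat; lra).
  pose proof (Rmult_le_compat_l p1 (Y1 M / p1) (q1 M) ltac:(lra) ltac:(lra)).
  assert (er : Rmax 0 (q1 M - Y1 M / p1) = q1 M - Y1 M / p1)
    by (apply Rmax_right; lra).
  apply the_NE_of_one_order; try lra.
  - split; simpl; [apply poor_lone_best_reply; lra |].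
    apply home_first_best_reply; try lra. unfold cost; lra.
  - intros e' N. right. simpl. apply (NE_rich_home_first_delta _ _ _ _ N); lra.
Qed.

(** * Determined evolutions *)

Definition forced_evolution (p10 p20 : R) (p1 p2 : nat -> R) (e : nat -> orders)
    : Prop :=
  evolution M p10 p20 p1 p2 e /\ forall t, the_NE M (p1 t) (p2 t) (e t).

(** A combination of existence and universality that a single explicit
    trajectory establishes at once. *)
Definition determined (p10 p20 : R)
    (P : (nat -> R) -> (nat -> R) -> (nat -> orders) -> Prop) : Prop :=
  (exists p1 p2 e, evolution M p10 p20 p1 p2 e) /\
  forall p1 p2 e, evolution M p10 p20 p1 p2 e -> P p1 p2 e.

Lemma adjust_unique (q qcons Yres p n n' : R) :
  adjust q qcons Yres p n -> adjust q qcons Yres p n' -> n = n'.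
Proof.
  intros (a & b & c) (a' & b' & c').
  destruct (Rlt_dec qcons q) as [h | h]; [rewrite a, a'; auto |].
  destruct (Rlt_dec (p * q) Yres) as [h' | h'];
    [rewrite b, b' | rewrite c, c']; auto.
Qed.

(** The predicate may be any property of sequences because a forced trajectory
    is equal, as a function, to every other evolution from the same prices. *)
Lemma forced_determined (p10 p20 : R) (p1 p2 : nat -> R) (e : nat -> orders)
    (P : (nat -> R) -> (nat -> R) -> (nat -> orders) -> Prop) :
  forced_evolution p10 p20 p1 p2 e -> P p1 p2 e -> determined p10 p20 P.
Proof.
  intros [(i1 & i2 & ev) ne] HP. split.
  { exists p1, p2, e. exact (conj i1 (conj i2 ev)). }
  intros p1' p2' e' (i1' & i2' & ev').
  assert (eq : forall t, p1' t = p1 t /\ p2' t = p2 t).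
  { induction t as [| t [E1 E2]]; [rewrite i1, i2; split; assumption |].
    destruct (ev t) as (_ & A1 & A2), (ev' t) as (N' & A1' & A2').
    rewrite E1, E2 in *. rewrite (proj2 (ne t) _ N') in *.
    split; eapply adjust_unique; eassumption. }
  replace p1' with p1
    by (apply functional_extensionality; intro t; symmetry; apply eq).
  replace p2' with p2
    by (apply functional_extensionality; intro t; symmetry; apply eq).
  replace e' with e; [exact HP |].
  apply functional_extensionality; intro t. symmetry. apply ne.
  destruct (eq t) as [E1 E2]. rewrite <- E1, <- E2. apply ev'.
Qed.

Lemma adjust_downward (q qcons Yres p n : R) :
  downward q qcons p n -> Yres <= p * q -> adjust q qcons Yres p n.
Proof.
  intros [h e] hY. repeat split; intros; [exact e | lra | lra].
Qed.

Lemma adjust_stay (q qcons Yres p : R) :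
  qcons = q -> Yres <= p * q -> adjust q qcons Yres p p.
Proof. intros e hY. repeat split; intros; lra. Qed.

(** No upward adjustment is possible because the income left after foreign
    purchases is what is spent at home, and at most [q1] is bought there. *)
Lemma pe_stationary (p1 p2 : R) :
  is_pe M p1 p2 -> exists e, the_NE M p1 p2 e /\
    adjust (q1 M) (q1cons e) (Y1res M p2 e) p1 p1 /\
    adjust (q2 M) (q2cons e) (Y2res M p1 e) p2 p2.
Proof.
  intros (hp1 & hp2 & e & N & c1 & c2 & b1 & b2). exists e.
  split; [exact N |].
  destruct N as [[[[[fI _] _] _] [[[fII _] _] _]] _].
  destruct fI as (_ & hb & _), fII as (_ & hg & _).
  split; (apply adjust_stay; [assumption |]); unfold Y1res, Y2res.
  - pose proof (Rmult_le_compat_l p1 (alpha e) (q1 M) hp1 ltac:(lra)). lra.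
  - pose proof (Rmult_le_compat_l p2 (delta e) (q2 M) hp2 ltac:(lra)). lra.
Qed.

Lemma one_step_determined (p10 p20 n1 n2 : R) (e0 : orders) :
  the_NE M p10 p20 e0 ->
  adjust (q1 M) (q1cons e0) (Y1res M p20 e0) p10 n1 ->
  adjust (q2 M) (q2cons e0) (Y2res M p10 e0) p20 n2 ->
  is_pe M n1 n2 ->
  determined p10 p20 (fun p1 p2 e =>
    p1 0%nat = p10 /\ p2 0%nat = p20 /\ e 0%nat = e0 /\
    forall t, (1 <= t)%nat -> p1 t = n1 /\ p2 t = n2).
Proof.
  intros N0 A1 A2 pe. destruct (pe_stationary _ _ pe) as (e1 & N1 & B1 & B2).
  set (switch := fun (A : Type) (x y : A) (t : nat) =>
                  match t with O => x | S _ => y end).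
  apply (forced_determined _ _ (switch R p10 n1) (switch R p20 n2)
           (switch orders e0 e1)).
  - split; [split; [reflexivity | split; [reflexivity |]] |];
      intros [| t]; simpl; repeat split; try assumption;
      first [apply A1 | apply A2 | apply B1 | apply B2 | apply N0 | apply N1].
  - repeat split; destruct t; (reflexivity || lia).
Qed.

(** * Reaching an equilibrium in one step *)

Lemma regime_E_determined (p10 p20 : R) :
  0 < p10 -> 0 < p20 -> - rho M <= p10 - p20 <= rho M -> zone_I M p10 p20 ->
  determined p10 p20 (regime_E M p10 p20).
Proof.
  intros hp1 hp2 hdp [hz1 hz2].
  assert (a1 : Y1 M / p10 < q1 M).
  { apply (Rmult_lt_reg_r p10); [lra |].
    replace (Y1 M / p10 * p10) with (Y1 M) by (field; lra). lra. }
  assert (a2 : Y2 M / p20 < q2 M).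
  { apply (Rmult_lt_reg_r p20); [lra |].
    replace (Y2 M / p20 * p20) with (Y2 M) by (field; lra). lra. }
  pose proof (the_NE_poor_home_first p10 p20 ltac:(lra) ltac:(lra)
                ltac:(lra) ltac:(lra)) as N.
  set (e0 := Orders (Y1 M / p10) 0 0 (Y2 M / p20)) in *.
  assert (d1 : downward (q1 M) (q1cons e0) p10 (Y1 M / q1 M)).
  { split; unfold q1cons; simpl; [lra | field; lra]. }
  assert (d2 : downward (q2 M) (q2cons e0) p20 (Y2 M / q2 M)).
  { split; unfold q2cons; simpl; [lra | field; lra]. }
  assert (K : typeE_eq M (Y1 M / q1 M) (Y2 M / q2 M)).
  { split; [| split; reflexivity].
    assert (0 < Y1 M / q1 M) by (apply Rdiv_lt_0_compat; lra).
    assert (0 < Y2 M / q2 M) by (apply Rdiv_lt_0_compat; lra).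
    split; [lra | split; [lra |]].
    eexists; split; [apply typeE_the_NE |]. simpl.
    repeat split; try lra; field; lra. }
  destruct (one_step_determined p10 p20 (Y1 M / q1 M) (Y2 M / q2 M) e0) as [ex un];
    try assumption.
  - apply adjust_downward; [assumption |]. unfold Y1res; simpl; lra.
  - apply adjust_downward; [assumption |]. unfold Y2res; simpl; lra.
  - apply K.
  - split; [exact ex |]. intros p1 p2 e ev.
    destruct (un _ _ _ ev) as (i1 & i2 & i3 & st).
    destruct (st 1%nat (le_n 1)) as [s1 s2].
    split; [exact N |]. unfold downward1, downward2, reached_after_one_step.
    rewrite i1, i2, i3, s1, s2.
    split; [exact d1 | split; [exact d2 | split; [exact K | exact st]]].
Qed.

(** Consumer II's spending in region I does not depend on [p2], so as [p1] stays
    put, lowering [p2] to (income left) / [q2] balances the budget in a single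
    step.  The price reached is nonnegative, and is [0] exactly when
    [(Y1, Y2)] lies on [l1]. *)
Lemma l4_regime_determined (p10 p20 : R) :
  0 < p10 -> p10 - p20 < - rho M -> zone_I M p10 p20 ->
  q1 M <= l1_side M p10 (Y1 M) (Y2 M) ->
  determined p10 p20 (fun p1 p2 e =>
    the_NE M p10 p20
      (Orders (Y1 M / p10) 0 (q1 M - Y1 M / p10)
         ((Y2 M - (p10 + rho M) * (q1 M - Y1 M / p10)) / p20)) /\
    downward2 M p2 e 0 /\ p1 1%nat = p10 /\
    reached_after_one_step (l4_eq M) p1 p2).
Proof.
  intros hp1 hdp [hz1 hz2] hl.
  pose proof (the_NE_foreign_sold_out p10 p20 hp1 ltac:(lra) ltac:(lra)
                ltac:(lra) hl) as N.
  unfold l1_side in hl.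
  assert (e1 : Y1 M / p10 * p10 = Y1 M) by (field; lra).
  assert (e2 : Y2 M / (p10 + rho M) * (p10 + rho M) = Y2 M) by (field; lra).
  assert (a1 : Y1 M / p10 < q1 M) by (apply (Rmult_lt_reg_r p10); lra).
  pose proof (Rmult_le_compat_r (p10 + rho M) (q1 M - Y1 M / p10)
                (Y2 M / (p10 + rho M)) ltac:(lra) ltac:(lra)) as a2.
  rewrite e2 in a2.
  pose proof (Rmult_le_pos (p10 + rho M) (q1 M - Y1 M / p10)
                ltac:(lra) ltac:(lra)) as a3.
  set (w := Y2 M - (p10 + rho M) * (q1 M - Y1 M / p10)) in *.
  assert (ew : w / p20 * p20 = w) by (field; lra).
  assert (en : w / q2 M * q2 M = w) by (field; lra).
  assert (hn : 0 <= w / q2 M)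
    by (apply (Rmult_le_reg_r (q2 M)); unfold w in *; lra).
  set (e0 := Orders (Y1 M / p10) 0 (q1 M - Y1 M / p10) (w / p20)) in *.
  assert (d2 : downward (q2 M) (q2cons e0) p20 (w / q2 M)).
  { split; unfold q2cons; simpl; [| field; lra].
    apply (Rmult_lt_reg_r p20); unfold w in *; lra. }
  assert (K : l4_eq M p10 (w / q2 M)).
  { split; [| repeat split].
    - split; [lra | split; [lra |]].
      eexists; split; [apply l4_the_NE; unfold w in *; lra |]. simpl.
      repeat split; unfold w in *; lra.
    - lra.
    - unfold w in *; lra.
    - unfold on_l4. rewrite en. unfold w. field. lra. }
  destruct (one_step_determined p10 p20 p10 (w / q2 M) e0) as [ex un];
    try assumption.
  - apply adjust_stay; unfold q1cons, Y1res; simpl; lra.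
  - apply adjust_downward; [assumption |]. unfold Y2res; simpl; lra.
  - apply K.
  - split; [exact ex |]. intros p1 p2 e ev.
    destruct (un _ _ _ ev) as (i1 & i2 & i3 & st).
    destruct (st 1%nat (le_n 1)) as [s1 s2].
    split; [exact N |]. unfold downward2, reached_after_one_step.
    rewrite i2, i3, s1, s2.
    split; [exact d2 | split; [reflexivity | split; [exact K | exact st]]].
Qed.

(** Multiplied by [p1 + rho], the equation of [l1] is that of [l4] without the
    term [p2 * q2]. *)
Lemma l4_eq_degenerate_of_on_l1 (p1 p2 : R) :
  0 < p1 -> l4_eq M p1 p2 -> on_l1 M p1 p2 (Y1 M) (Y2 M) ->
  degenerate_l1_eq M p1 p2.
Proof.
  intros hp (pe & _ & _ & l4) l1.
  split; [exact pe | split; [exact hp | split; [| exact l1]]].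
  unfold on_l4 in l4. unfold on_l1, l1_side in l1.
  apply (Rmult_eq_reg_r (q2 M)); [| lra].
  replace ((p1 + rho M) * q1 M) with ((p1 + rho M) / p1 * Y1 M + Y2 M) in l4
    by (rewrite l1; field; lra).
  lra.
Qed.

(** * The infinite downward process *)

(** The downward rule when both incomes are entirely spent in region I; it
    simplifies to [(Y1 + Y2 * p / (p + rho)) / q1]. *)
Definition next_price (p : R) : R := p * l1_side M p (Y1 M) (Y2 M) / q1 M.

(** Clearing denominators in [l1_side p = q1] gives
    [q1 p^2 - s p - rho Y1 = 0] with [s = Y1 + Y2 - rho q1]; the constant term
    is negative, so exactly one root is positive, the one with [+ sqrt]. *)
Lemma p1_infinity_spec :
  0 < p1_infinity M /\ l1_side M (p1_infinity M) (Y1 M) (Y2 M) = q1 M.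
Proof.
  unfold p1_infinity. cbv zeta.
  set (s := Y1 M + Y2 M - rho M * q1 M).
  set (D := s ^ 2 + 4 * rho M * q1 M * Y1 M).
  pose proof (Rmult_lt_0_compat _ _ (Rmult_lt_0_compat _ _ hrho hq1) hY1) as hpos.
  assert (hD : s ^ 2 < D) by (unfold D; lra).
  assert (h0 : 0 <= s ^ 2) by apply pow2_ge_0.
  assert (hs : - s < sqrt D).
  { apply Rle_lt_trans with (Rabs s).
    - rewrite <- Rabs_Ropp. apply Rle_abs.
    - rewrite <- sqrt_Rsqr_abs. apply sqrt_lt_1; unfold Rsqr; lra. }
  assert (hsq : sqrt D * sqrt D = D) by (apply sqrt_sqrt; lra).
  set (p := 1 / (2 * q1 M) * (s + sqrt D)).
  assert (ep : 2 * q1 M * p - s = sqrt D) by (unfold p; field; lra).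
  assert (hp : 0 < p).
  { unfold p. apply Rmult_lt_0_compat; [apply Rdiv_lt_0_compat |]; lra. }
  split; [exact hp |]. unfold l1_side.
  apply (Rmult_eq_reg_r (p * (p + rho M)));
    [| apply Rgt_not_eq, Rmult_lt_0_compat; lra].
  replace ((Y1 M / p + Y2 M / (p + rho M)) * (p * (p + rho M)))
    with (Y1 M * (p + rho M) + Y2 M * p) by (field; lra).
  rewrite <- ep in hsq. unfold D in hsq.
  apply (Rmult_eq_reg_l (4 * q1 M)); [| lra].
  unfold s in hsq. ring_simplify in hsq. ring_simplify. lra.
Qed.

Lemma l1_side_decreasing (p p' : R) :
  0 < p < p' -> l1_side M p' (Y1 M) (Y2 M) < l1_side M p (Y1 M) (Y2 M).
Proof.
  intros hp. unfold l1_side. apply Rplus_lt_compat;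
    (apply Rmult_lt_compat_l; [lra |]; apply Rinv_lt_contravar; [| lra];
     apply Rmult_lt_0_compat; lra).
Qed.

(** With [p'] the fixed point, [next_price p - p'] is
    [k * (p - p') * (rho / (p + rho))], where [k = Y2 / (p' + rho) / q1] is the
    share of consumer II in region I's supply at the limit.  It is less than
    [1] because consumer I's share [Y1 / p' / q1] is positive. *)
Lemma next_price_contracts :
  exists k, 0 <= k < 1 /\ forall p, p1_infinity M < p ->
    0 < next_price p - p1_infinity M <= k * (p - p1_infinity M).
Proof.
  destruct p1_infinity_spec as [hp hfix]. set (p' := p1_infinity M) in *.
  unfold l1_side in hfix.
  assert (0 < Y1 M / p') by (apply Rdiv_lt_0_compat; lra).
  assert (hb : 0 < Y2 M / (p' + rho M)) by (apply Rdiv_lt_0_compat; lra).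
  exists (Y2 M / (p' + rho M) / q1 M).
  assert (hk : 0 < Y2 M / (p' + rho M) / q1 M) by (apply Rdiv_lt_0_compat; lra).
  split.
  - split; [lra |]. apply (Rmult_lt_reg_r (q1 M)); [lra |].
    replace (Y2 M / (p' + rho M) / q1 M * q1 M) with (Y2 M / (p' + rho M))
      by (field; lra). lra.
  - intros p h.
    assert (E : next_price p - p' =
      Y2 M / (p' + rho M) / q1 M * (p - p') * (rho M / (p + rho M))).
    { unfold next_price, l1_side.
      replace p' with (p' * (Y1 M / p' + Y2 M / (p' + rho M)) / q1 M) at 1
        by (rewrite hfix; field; lra).
      field. lra. }
    rewrite E.
    assert (0 < rho M / (p + rho M)) by (apply Rdiv_lt_0_compat; lra).
    assert (rho M / (p + rho M) <= 1).
    { apply (Rmult_le_reg_r (p + rho M)); [lra |].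
      replace (rho M / (p + rho M) * (p + rho M)) with (rho M) by (field; lra). lra. }
    assert (hx : 0 < Y2 M / (p' + rho M) / q1 M * (p - p'))
      by (apply Rmult_lt_0_compat; lra).
    split; [apply Rmult_lt_0_compat; lra |].
    rewrite <- (Rmult_1_r (_ * (p - p'))) at 2.
    apply Rmult_le_compat_l; lra.
Qed.

(** The price [p1] stays above the fixed point [p1_infinity], hence
    [(Y1, Y2)] stays strictly below the current line [l1]: region I is never
    sold out, which is what triggers each further decrease. *)
Lemma infinite_l1_determined (p10 p20 : R) :
  0 < p10 -> p10 - p20 < - rho M -> zone_I M p10 p20 ->
  l1_side M p10 (Y1 M) (Y2 M) < q1 M ->
  determined p10 p20 (regime_infinite_l1 M p10 p20).
Proof.
  intros hp1 hdp [hz1 hz2] hl.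
  destruct p1_infinity_spec as [hinf hfix].
  destruct next_price_contracts as (k & hk & hstep).
  set (pinf := p1_infinity M) in *.
  set (p1 := fun t => Nat.iter t next_price p10).
  set (p2 := fun t : nat => match t with O => p20 | S _ => 0 end).
  set (e := fun t : nat =>
         Orders (Y1 M / p1 t) 0 (Y2 M / (p1 t + rho M))
                (match t with O => 0 | S _ => q2 M end)).
  assert (above : forall t, pinf < p1 t).
  { induction t as [| t IH]; simpl.
    - destruct (Rlt_le_dec pinf p10) as [h | h]; [exact h |].
      destruct h as [h | h].
      + pose proof (l1_side_decreasing p10 pinf ltac:(lra)). lra.
      + rewrite h in hl. lra.
    - pose proof (hstep _ IH). unfold p1 in *. lra. }
  assert (below : forall t, l1_side M (p1 t) (Y1 M) (Y2 M) < q1 M).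
  { intro t. rewrite <- hfix. apply l1_side_decreasing. split; [lra | apply above]. }
  assert (NE : forall t, the_NE M (p1 t) (p2 t) (e t)).
  { intro t. pose proof (above t). pose proof (below t).
    destruct t as [| t].
    - apply the_NE_foreign_unsold; simpl in *; lra.
    - apply the_NE_free; lra. }
  assert (down : forall t, downward1 M p1 e t).
  { intro t. split; [exact (below t) | reflexivity]. }
  apply (forced_determined _ _ p1 p2 e).
  - split; [split; [reflexivity | split; [reflexivity |]] | exact NE].
    intro t. split; [apply NE |].
    pose proof (above t) as ha. pose proof (below t) as hb. unfold l1_side in hb.
    assert (0 < Y2 M / (p1 t + rho M)) by (apply Rdiv_lt_0_compat; lra).
    assert (e1 : Y1 M / p1 t * p1 t = Y1 M) by (field; lra).
    assert (e2 : Y2 M / (p1 t + rho M) * (p1 t + rho M) = Y2 M) by (field; lra).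
    pose proof (Rmult_le_compat_r (p1 t) (Y1 M / p1 t) (q1 M) ltac:(lra) ltac:(lra)).
    split.
    + apply adjust_downward; [apply down |].
      unfold Y1res. simpl. lra.
    + destruct t as [| t].
      * apply adjust_downward.
        -- split; unfold q2cons; simpl; [lra | field; lra].
        -- unfold Y2res. simpl in *. lra.
      * apply adjust_stay; [unfold q2cons; simpl; lra |].
        unfold Y2res. simpl in *. lra.
  - split; [exact (NE 0%nat) |]. fold pinf. split; [| split; [| split]].
    + intros [| t] ht; [lia | reflexivity].
    + intro t. split; [apply down |].
      pose proof (above t) as ha. pose proof (below t) as hb.
      change (next_price (p1 t) < p1 t). unfold next_price.
      apply (Rmult_lt_reg_r (q1 M)); [lra |].
      replace (p1 t * l1_side M (p1 t) (Y1 M) (Y2 M) / q1 M * q1 M)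
        with (p1 t * l1_side M (p1 t) (Y1 M) (Y2 M)) by (field; lra).
      apply Rmult_lt_compat_l; lra.
    + apply (geometric_cv p1 pinf k hk). intro t.
      pose proof (hstep _ (above t)) as h. change (p1 (S t)) with (next_price (p1 t)). lra.
    + split; [| split; [lra | split; [reflexivity |]]].
      * split; [lra | split; [lra |]].
        eexists; split; [apply the_NE_free; lra |]. unfold l1_side in hfix. simpl.
        repeat split; try lra; field; lra.
      * unfold on_l1. lra.
Qed.

End PositiveMarket.

(** * Exchanging the two regions *)

Definition swap_market (M : market) : market :=
  Market (q2 M) (q1 M) (Y2 M) (Y1 M) (rho M).
Definition swap_orders (e : orders) : orders :=
  Orders (delta e) (gamma e) (beta e) (alpha e).

(** The definition of equilibrium is literally symmetric, so the exchange of
    regions permutes its two components. *)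
Lemma the_NE_swap (M : market) (p1 p2 : R) (e : orders) :
  the_NE (swap_market M) p2 p1 (swap_orders e) -> the_NE M p1 p2 e.
Proof.
  intros [[n1 n2] u]. split; [split; assumption |].
  intros e' [m1 m2].
  pose proof (u (swap_orders e') (conj m2 m1)) as E.
  destruct e, e'. injection E; intros; subst; reflexivity.
Qed.

Lemma is_pe_swap (M : market) (p1 p2 : R) :
  is_pe (swap_market M) p2 p1 -> is_pe M p1 p2.
Proof.
  intros (h2 & h1 & e & N & H). split; [exact h1 | split; [exact h2 |]].
  exists (swap_orders e). split.
  - apply the_NE_swap. destruct e. exact N.
  - simpl in *. lra.
Qed.

Lemma q1cons_swap (e : orders) : q1cons (swap_orders e) = q2cons e.
Proof. unfold q1cons, q2cons; simpl; ring. Qed.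

Lemma q2cons_swap (e : orders) : q2cons (swap_orders e) = q1cons e.
Proof. unfold q1cons, q2cons; simpl; ring. Qed.

Lemma evolution_swap (M : market) (p10 p20 : R) (p1 p2 : nat -> R)
    (e : nat -> orders) :
  evolution M p10 p20 p1 p2 e ->
  evolution (swap_market M) p20 p10 p2 p1 (fun t => swap_orders (e t)).
Proof.
  intros (i1 & i2 & H). split; [exact i2 | split; [exact i1 |]].
  intro t. destruct (H t) as ((n1 & n2) & A1 & A2).
  rewrite q1cons_swap, q2cons_swap.
  repeat split; solve [apply n1 | apply n2 | apply A1 | apply A2].
Qed.

Lemma determined_swap (M : market) (p10 p20 : R)
    (P Q : (nat -> R) -> (nat -> R) -> (nat -> orders) -> Prop) :
  determined (swap_market M) p20 p10 P ->
  (forall p1 p2 e, P p2 p1 (fun t => swap_orders (e t)) -> Q p1 p2 e) ->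
  determined M p10 p20 Q.
Proof.
  intros [(p2 & p1 & e & ev) un] PQ. split.
  - exists p1, p2, (fun t => swap_orders (e t)).
    destruct M. exact (evolution_swap _ _ _ _ _ _ ev).
  - intros p1' p2' e' ev'. apply PQ, un, evolution_swap, ev'.
Qed.

Lemma l2_side_swap (M : market) (p y1 y2 : R) :
  l1_side (swap_market M) p y2 y1 = l2_side M p y1 y2.
Proof. unfold l1_side, l2_side; simpl; ring. Qed.

Lemma zone_I_swap (M : market) (p10 p20 : R) :
  zone_I M p10 p20 -> zone_I (swap_market M) p20 p10.
Proof. intros [h1 h2]. split; assumption. Qed.

Lemma l4_eq_swap (M : market) (p1 p2 : R) :
  0 < p2 -> l4_eq (swap_market M) p2 p1 -> l3_eq M p1 p2.
Proof.
  intros hp2 (pe & h1 & h2 & h4). pose proof (is_pe_swap _ _ _ pe) as pe'.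
  split; [exact pe' |]. split; [apply pe' |]. simpl in *.
  repeat split; try assumption. unfold on_l4 in h4. unfold on_l3. simpl in h4. lra.
Qed.

Lemma regime_l3_determined (M : market) (p10 p20 : R) :
  0 < q1 M -> 0 < q2 M -> 0 < Y1 M -> 0 < Y2 M -> 0 < rho M ->
  0 < p20 -> rho M < p10 - p20 -> zone_I M p10 p20 ->
  q2 M <= l2_side M p20 (Y1 M) (Y2 M) ->
  determined M p10 p20 (regime_l3 M p10 p20).
Proof.
  intros hq1 hq2 hY1 hY2 hr hp2 hdp hz hl.
  eapply determined_swap.
  - apply (l4_regime_determined (swap_market M)); simpl; try assumption; try lra.
    + apply zone_I_swap, hz.
    + rewrite l2_side_swap. exact hl.
  - simpl. intros p1 p2 e (N & [d1 d2] & s & K & st).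
    split; [apply the_NE_swap; exact N |].
    split; [unfold downward1; rewrite q2cons_swap in d1, d2; split; assumption |].
    split; [exact s |]. split.
    + apply l4_eq_swap; [rewrite s; exact hp2 | exact K].
    + intros t ht. destruct (st t ht); split; assumption.
Qed.

Lemma infinite_l2_determined (M : market) (p10 p20 : R) :
  0 < q1 M -> 0 < q2 M -> 0 < Y1 M -> 0 < Y2 M -> 0 < rho M ->
  0 < p20 -> rho M < p10 - p20 -> zone_I M p10 p20 ->
  l2_side M p20 (Y1 M) (Y2 M) < q2 M ->
  determined M p10 p20 (fun p1 p2 e =>
    the_NE M p10 p20 (Orders 0 (Y1 M / (p20 + rho M)) 0 (Y2 M / p20)) /\
    exists p2inf, tends_to_degenerate_l2 M p1 p2 e p2inf).
Proof.
  intros hq1 hq2 hY1 hY2 hr hp2 hdp hz hl.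
  eapply determined_swap.
  - apply (infinite_l1_determined (swap_market M)); simpl; try assumption; try lra.
    + apply zone_I_swap, hz.
    + rewrite l2_side_swap. exact hl.
  - intros p1 p2 e (N & z & d & cv & pe & hp & _ & hl1).
    split; [apply the_NE_swap; exact N |].
    exists (p1_infinity (swap_market M)).
    split; [exact z |]. split; [| split; [exact cv |]].
    + intro t. destruct (d t) as [dt hlt]. split; [| exact hlt].
      unfold downward1 in dt. rewrite q1cons_swap in dt. exact dt.
    + split; [apply is_pe_swap, pe | split; [reflexivity | split; [exact hp |]]].
      unfold on_l1 in hl1. simpl in hl1. rewrite l2_side_swap in hl1. exact hl1.
Qed.

(** * The three zones *)

(** The sides of [l1] and [l2], multiplied by [p1] and [p2 + rho], become
    [Y1 + Y2 * (p1 / (p1 + rho))] and [Y1 + Y2 * ((p2 + rho) / p2)], and the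
    two ratios are separated by [1]. *)
Lemma below_l2_below_l1 (M : market) (p1 p2 : R) :
  0 < Y1 M -> 0 < Y2 M -> 0 < rho M -> 0 < p1 -> 0 < p2 ->
  (p2 + rho M) * q2 M <= p1 * q1 M ->
  l2_side M p2 (Y1 M) (Y2 M) < q2 M -> l1_side M p1 (Y1 M) (Y2 M) < q1 M.
Proof.
  intros hY1 hY2 hr hp1 hp2 hq h.
  apply (Rmult_lt_reg_l p1); [exact hp1 |].
  eapply Rlt_le_trans; [| exact hq].
  eapply Rle_lt_trans; [| apply Rmult_lt_compat_l; [| exact h]; lra].
  unfold l1_side, l2_side.
  replace (p1 * (Y1 M / p1 + Y2 M / (p1 + rho M)))
    with (Y1 M + Y2 M * (p1 / (p1 + rho M))) by (field; lra).
  replace ((p2 + rho M) * (Y1 M / (p2 + rho M) + Y2 M / p2))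
    with (Y1 M + Y2 M * ((p2 + rho M) / p2)) by (field; lra).
  apply Rplus_le_compat_l, Rmult_le_compat_l; [lra |].
  apply Rle_trans with 1.
  - apply (Rmult_le_reg_r (p1 + rho M)); [lra |].
    replace (p1 / (p1 + rho M) * (p1 + rho M)) with p1 by (field; lra). lra.
  - apply (Rmult_le_reg_r p2); [lra |].
    replace ((p2 + rho M) / p2 * p2) with (p2 + rho M) by (field; lra). lra.
Qed.

Theorem proposition4p4 (M : market) (p10 p20 : R)
  (hq1 : 0 < q1 M) (hq2 : 0 < q2 M) (hY1 : 0 < Y1 M) (hY2 : 0 < Y2 M)
  (hrho : 0 < rho M) (hp10 : 0 < p10) (hp20 : 0 < p20)
  (hq : (p20 + rho M) * q2 M <= p10 * q1 M)
  (hzone : zone_I M p10 p20) :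
  (* the three zones partition zone I *)
  ((zone_I1 M p10 p20 \/ zone_I2 M p10 p20 \/ zone_I3 M p10 p20) /\
   ~ (zone_I1 M p10 p20 /\ zone_I2 M p10 p20) /\
   ~ (zone_I1 M p10 p20 /\ zone_I3 M p10 p20) /\
   ~ (zone_I2 M p10 p20 /\ zone_I3 M p10 p20)) /\
  (* the price evolution exists, and every one behaves as described *)
  (exists p1 p2 e, evolution M p10 p20 p1 p2 e) /\
  forall (p1 p2 : nat -> R) (e : nat -> orders),
    evolution M p10 p20 p1 p2 e ->
    let dp := p10 - p20 in
    (zone_I1 M p10 p20 ->
      (- rho M <= dp <= rho M -> regime_E M p10 p20 p1 p2 e) /\
      (dp < - rho M ->
         the_NE M p10 p20
           (Orders (Y1 M / p10) 0 (q1 M - Y1 M / p10)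
              ((Y2 M - (p10 + rho M) * (q1 M - Y1 M / p10)) / p20)) /\
         (above_l1 M p10 p20 (Y1 M) (Y2 M) ->
            downward2 M p2 e 0 /\ p1 1%nat = p10 /\
            reached_after_one_step (l4_eq M) p1 p2) /\
         (on_l1 M p10 p20 (Y1 M) (Y2 M) ->
            reached_after_one_step (degenerate_l1_eq M) p1 p2 /\
            (forall t : nat, (1 <= t)%nat -> p2 t = 0))) /\
      (rho M < dp -> regime_l3 M p10 p20 p1 p2 e)) /\
    (zone_I2 M p10 p20 ->
      (- rho M <= dp <= rho M -> regime_E M p10 p20 p1 p2 e) /\
      (dp < - rho M -> regime_infinite_l1 M p10 p20 p1 p2 e) /\
      (rho M < dp -> regime_l3 M p10 p20 p1 p2 e)) /\
    (zone_I3 M p10 p20 ->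
      (- rho M <= dp <= rho M -> regime_E M p10 p20 p1 p2 e) /\
      (dp < - rho M -> regime_infinite_l1 M p10 p20 p1 p2 e) /\
      (rho M < dp ->
         the_NE M p10 p20
           (Orders 0 (Y1 M / (p20 + rho M)) 0 (Y2 M / p20)) /\
         exists p2inf : R, tends_to_degenerate_l2 M p1 p2 e p2inf)).
Proof.
  pose proof (below_l2_below_l1 M p10 p20 hY1 hY2 hrho hp10 hp20 hq) as zones.
  unfold zone_I1, zone_I2, zone_I3. cbv zeta.
  set (s1 := l1_side M p10 (Y1 M) (Y2 M)) in *.
  set (s2 := l2_side M p20 (Y1 M) (Y2 M)) in *.
  split.
  { split; [| split; [| split]]; [| intros [[_ ?] [_ ?]]; tauto || lra ..].
    destruct (Rlt_le_dec s2 (q2 M)); [tauto |].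
    destruct (Rlt_le_dec s1 (q1 M)); tauto. }
  destruct (Rlt_le_dec (p10 - p20) (- rho M)) as [hlo | hlo].
  - destruct (Rlt_le_dec s1 (q1 M)) as [h1 | h1].
    + destruct (infinite_l1_determined M hq1 hq2 hY1 hY2 hrho p10 p20)
        as [ex un]; try assumption.
      split; [exact ex |]. intros p1 p2 e ev. specialize (un _ _ _ ev).
      split; [intros [_ ?]; lra |].
      split; intros _; (split; [intro; exfalso; lra |]);
        (split; [intros _; exact un | intro; exfalso; lra]).
    + destruct (l4_regime_determined M hq2 hY1 hrho p10 p20)
        as [ex un]; try assumption.
      split; [exact ex |]. intros p1 p2 e ev.
      destruct (un _ _ _ ev) as (N & d & s & K & st).
      split; [| split; [intros [_ [? _]]; lra | intros [_ h]; specialize (zones h); lra]].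
      intros _. split; [intro; exfalso; lra |].
      split; [intros _ | intro; exfalso; lra].
      split; [exact N |]. split.
      { intros _. split; [exact d | split; [exact s | split; [exact K | exact st]]]. }
      intro hl.
      assert (G : degenerate_l1_eq M (p1 1%nat) (p2 1%nat)).
      { apply l4_eq_degenerate_of_on_l1; try assumption; rewrite s; assumption. }
      split; [split; [exact G | exact st] |].
      intros t ht. rewrite (proj2 (st t ht)). apply G.
  - destruct (Rlt_le_dec (rho M) (p10 - p20)) as [hhi | hhi].
    + destruct (Rlt_le_dec s2 (q2 M)) as [h2 | h2].
      * specialize (zones h2).
        destruct (infinite_l2_determined M p10 p20) as [ex un]; try assumption.
        split; [exact ex |]. intros p1 p2 e ev. specialize (un _ _ _ ev).
        split; [intros [_ ?]; lra |]. split; [intros [_ [_ ?]]; lra |].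
        intros _. split; [intro; exfalso; lra |].
        split; [intro; exfalso; lra | intros _; exact un].
      * destruct (regime_l3_determined M p10 p20) as [ex un]; try assumption.
        split; [exact ex |]. intros p1 p2 e ev. specialize (un _ _ _ ev).
        split; [| split; [| intros [_ ?]; lra]]; intros _;
          (split; [intro; exfalso; lra |]);
          (split; [intro; exfalso; lra | intros _; exact un]).
    + destruct (regime_E_determined M hq1 hq2 hY1 hY2 hrho p10 p20)
        as [ex un]; try assumption; try lra.
      split; [exact ex |]. intros p1 p2 e ev. specialize (un _ _ _ ev).
      split; [| split]; intros _; (split; [intros _; exact un |]);
        split; intro; exfalso; lra.
Qed.
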